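(* Let $A$ be a unital $C^*$-algebra of real rank zero and let $B$ be a unital (complex) Banach algebra. Let $\Phi:A\to B$ be a bounded linear map such that, for all $a,b\in A$, $a\leq^- b$ implies $\Phi(a)\leq^-\Phi(b)$. Then: (1) If $\Phi(1)\in B^\bullet$, then $\Phi$ is a Jordan homomorphism. (2) If $\Phi(A)\cap B^{-1}\neq\emptyset$ and $\Phi(1)\in B^\wedge$, then $\Phi$ is a Jordan homomorphism multiplied by an invertible element, i.e. there exist an invertible $c\in B$ and a Jordan homomorphism $\Psi:A\to B$ such that $\Phi(x)=c\,\Psi(x)$ for all $x\in A$.
   Context: For a unital ring $R$, an element $a\in R$ is regular if there is $x\in R$ with $axa=a$; $R^\wedge$ is the set of regular elements, $R^\bullet$ the set of idempotents and $R^{-1}$ the set of invertible elements. Write $\mathrm{ann}_l(a)=\{x\in R: xa=0\}$ and $\mathrm{ann}_r(a)=\{x\in R: ax=0\}$. For $a,b\in R$, $a\leq^- b$ means that there exist $p,q\in R^\bullet$ with $\mathrm{ann}_l(a)=\mathrm{ann}_l(p)$, $\mathrm{ann}_r(a)=\mathrm{ann}_r(q)$, $pa=pb$ and $aq=bq$. A $C^*$-algebra $A$ is of real rank zero if the set of all real linear combinations of orthogonal projections is dense in the set of all hermitian elements of $A$. A linear map $\Psi:A\to B$ is a Jordan homomorphism if $\Psi(a^2)=\Psi(a)^2$ for all $a\in A$. *)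

(* Defs.v *)
From HB Require Import structures.
From mathcomp Require Import all_boot all_order all_algebra.
From mathcomp Require Import complex.
From mathcomp Require Import all_classical all_reals all_analysis.

Set Implicit Arguments.
Unset Strict Implicit.
Unset Printing Implicit Defensive.

Import Order.TTheory GRing.Theory Num.Theory.
Import numFieldNormedType.Exports.

Local Open Scope classical_set_scope.
Local Open Scope ring_scope.
Local Open Scope complex_scope.

Section Ring.
Variable A : pzRingType.
Implicit Types a b p q x : A.

Definition is_regular a := exists x, a * x * a = a.

Definition is_idempotent p := p * p = p.

Definition is_invertible a := exists x, x * a = 1 /\ a * x = 1.

Definition ann_l a : set A := [set x | x * a = 0].

Definition ann_r a : set A := [set x | a * x = 0].

Definition minus_le a b := exists p q,
  [/\ is_idempotent p, is_idempotent q, ann_l a = ann_l p & ann_r a = ann_r q] /\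
  (p * a = p * b /\ a * q = b * q).

End Ring.

(* Unital complex Banach algebras over C = R[i]; norms take their values in the
   nonnegative reals of R[i]. This is a record, not an HB structure, since the
   hierarchy cannot join rings with normed modules: numDomainType inherits from
   both without a declared join. Nor does the record extend algType, which
   requires 1 != 0: the zero algebra is allowed. `|1| = 1 is not imposed. *)
Record banachAlgType (R : realType) := BanachAlg {
  banach_carrier : completeNormedModType R[i];
  banach_mul : banach_carrier -> banach_carrier -> banach_carrier;
  banach_one : banach_carrier;
  banach_mulA : associative banach_mul;
  banach_mul1l : left_id banach_one banach_mul;
  banach_mul1r : right_id banach_one banach_mul;
  banach_mulDl : left_distributive banach_mul +%R;
  banach_mulDr : right_distributive banach_mul +%R;
  banach_mulZl : forall (k : R[i]) x y,
    banach_mul (k *: x) y = k *: banach_mul x y;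
  banach_mulZr : forall (k : R[i]) x y,
    banach_mul x (k *: y) = k *: banach_mul x y;
  banach_normM : forall x y, `|banach_mul x y| <= `|x| * `|y|
}.

(* The named sort is the key of the normed module and ring instances. *)
Definition banach_sort (R : realType) (A : banachAlgType R) : Type :=
  banach_carrier A.
Coercion banach_sort : banachAlgType >-> Sortclass.

HB.instance Definition _ (R : realType) (A : banachAlgType R) :=
  CompleteNormedModule.copy (banach_sort A) (banach_carrier A).

HB.instance Definition _ (R : realType) (A : banachAlgType R) :=
  GRing.Zmodule_isPzRing.Build (banach_sort A) (@banach_mulA R A)
    (@banach_mul1l R A) (@banach_mul1r R A)
    (@banach_mulDl R A) (@banach_mulDr R A).

Section BanachTheory.
Variables (R : realType) (A : banachAlgType R).
Implicit Types (k : R[i]) (x y : A).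

Lemma banach_scalerAl k x y : k *: (x * y) = (k *: x) * y.
Proof. by rewrite [RHS]banach_mulZl. Qed.

Lemma banach_scalerAr k x y : k *: (x * y) = x * (k *: y).
Proof. by rewrite [RHS]banach_mulZr. Qed.

Lemma banach_ler_normM x y : `|x * y| <= `|x| * `|y|.
Proof. exact: banach_normM. Qed.

End BanachTheory.

Record cstarAlgType (R : realType) := CStarAlg {
  cstar_banach :> banachAlgType R;
  star : cstar_banach -> cstar_banach;
  starK : involutive star;
  starD : forall x y, star (x + y) = star x + star y;
  starZ : forall (k : R[i]) x, star (k *: x) = k^* *: star x;
  starM : forall x y, star (x * y) = star y * star x;
  norm_starM : forall x, `|star x * x| = `|x| ^+ 2
}.

Section CStar.
Variables (R : realType) (A : cstarAlgType R).

Definition is_hermitian (x : A) := star x = x.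

Definition is_projection (p : A) := is_idempotent p /\ is_hermitian p.

Definition orth_proj_comb : set A := [set x | exists (n : nat)
  (l : 'I_n -> R) (p : 'I_n -> A),
  [/\ forall i, is_projection (p i),
      forall i j, i != j -> p i * p j = 0
    & x = \sum_(i < n) (l i)%:C *: p i]].

(* Since orth_proj_comb consists of hermitian elements, this is density in the
   subspace of hermitian elements. *)
Definition real_rank_zero := [set x | is_hermitian x] `<=` closure orth_proj_comb.

End CStar.

Section Maps.
Variables (R : realType) (A B : banachAlgType R).

Definition bounded_linear (f : {linear A -> B}) :=
  exists M : R, forall x, `|f x| <= M%:C * `|x|.

Definition jordan_hom (f : {linear A -> B}) :=
  forall a, f (a ^+ 2) = f a ^+ 2.

End Maps.

(* Main.v *)
(** An element below an idempotent in the minus order is idempotent.  As every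
    idempotent [p] satisfies [p <=^- 1], the map [Phi] sends projections to
    idempotents when [Phi 1] is idempotent, hence orthogonal projections to
    orthogonal idempotents; so [Phi (x ^+ 2) = Phi x ^+ 2] holds for real
    combinations of orthogonal projections, by density for hermitian [x], and
    by polarization for all [x].  If [g] is a generalized inverse of
    [h = Phi 1], then [Phi p] lies in [h B] and in [B h] for each projection
    [p], so [h g Phi x = Phi x = Phi x g h] for all [x], again by density; an
    invertible value of [Phi] thus makes [h] invertible with inverse [g], and
    the first part applies to [g Phi]. *)
Require Import Defs.
From HB Require Import structures.
From mathcomp Require Import all_boot all_order all_algebra.
From mathcomp Require Import complex.
From mathcomp Require Import all_classical all_reals all_analysis.

Set Implicit Arguments.
Unset Strict Implicit.
Unset Printing Implicit Defensive.

Import Order.TTheory GRing.Theory Num.Theory.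
Import numFieldNormedType.Exports.

Local Open Scope ring_scope.

Section MinusOrder.
Variable B : pzRingType.
Implicit Types a b p q : B.

Lemma idempotent_minus_le1 p : is_idempotent p -> minus_le p 1.
Proof. by move=> pp; exists p, p; rewrite mulr1 mul1r pp. Qed.

(** As [1 - p] kills the idempotent [p] from the left, equality of annihilators makes it kill [a]
    too; symmetrically for [1 - q] on the right. *)
Lemma minus_le_factor a b : minus_le a b ->
  exists p q, [/\ is_idempotent q, p * a = a, a = p * b & a = b * q].
Proof.
move=> [p [q [[pp qq /seteqP[_ lp] /seteqP[_ rq]] [pab aqb]]]].
have pa : p * a = a.
  have /lp /= : ann_l p (1 - p) by rewrite /ann_l /= mulrBl mul1r pp subrr.
  by rewrite /ann_l /= mulrBl mul1r => /subr0_eq.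
have aq : a * q = a.
  have /rq /= : ann_r q (1 - q) by rewrite /ann_r /= mulrBr mulr1 qq subrr.
  by rewrite /ann_r /= mulrBr mulr1 => /subr0_eq.
by exists p, q; split=> //; rewrite -?pab -?aqb ?pa ?aq.
Qed.

(** [a * a = (p * b) * (b * q) = p * (b * q) = p * a = a]. *)
Lemma minus_le_idempotent a b :
  minus_le a b -> is_idempotent b -> is_idempotent a.
Proof.
move=> /minus_le_factor[p [q [_ pa apb abq]]] bb; rewrite /is_idempotent.
by rewrite {1}apb {1}abq !mulrA -(mulrA p) bb -(mulrA p) -abq.
Qed.

(** [a] is a right and a left multiple of [b]; [b * g] fixes the former from the left, [g * b] the
    latter from the right. *)
Lemma minus_le_geninv a b g : minus_le a b -> b * g * b = b ->
  b * g * a = a /\ a * g * b = a.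
Proof.
move=> /minus_le_factor[p [q [_ _ apb abq]]] bgb; split.
  by rewrite abq mulrA bgb.
by rewrite apb -!mulrA (mulrA b) bgb.
Qed.

End MinusOrder.

Section Banach.
Local Open Scope classical_set_scope.
Variables (R : realType) (A : banachAlgType R).

Lemma banach_cvgM (T : Type) (F : set_system T) (FF : Filter F)
    (f g : T -> A) (a b : A) :
  f x @[x --> F] --> a -> g x @[x --> F] --> b ->
  f x * g x @[x --> F] --> a * b.
Proof.
move=> fa gb; apply/cvgrPdist_lt => e e0.
(* Scalar bound for the norm of [a * b - f x * g x = (a - f x) * g x + a * (b - g x)]. *)
have : `|a - f x| * `|g x| + `|a| * `|b - g x| @[x --> F] --> (0 : R[i]^o).
  rewrite -(addr0 0) -{2}(mulr0 `|a|) -{1}(mul0r `|b|).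
  apply: cvgD; apply: cvgM; [|exact: cvg_norm|exact: cvg_cst|].
    by apply/norm_cvg0P; rewrite -(subrr a); apply: cvgB => //; exact: cvg_cst.
  by apply/norm_cvg0P; rewrite -(subrr b); apply: cvgB => //; exact: cvg_cst.
move=> /cvgr0_norm_lt/(_ e e0); apply: filterS => x.
rewrite ger0_norm ?addr_ge0 ?mulr_ge0//; apply: le_lt_trans.
have -> : a * b - f x * g x = (a - f x) * g x + a * (b - g x).
  by rewrite mulrBl mulrBr [RHS]addrC subrKA.
by rewrite (le_trans (ler_normD _ _))// lerD// banach_ler_normM.
Qed.

Lemma banach_sqr_continuous : continuous (fun x : A => x ^+ 2).
Proof. by move=> x; apply: (@banach_cvgM _ _ _ id id); exact: cvg_id. Qed.

(** Expanding the square gives [q * p = - (p * q)], so [p * q * p] equals both [p * q] and its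
    opposite; the scalar 2 can be cancelled. *)
Lemma idempotentD_orthogonal (p q : A) : is_idempotent p -> is_idempotent q ->
  is_idempotent (p + q) -> p * q = 0.
Proof.
rewrite /is_idempotent => pp qq.
rewrite mulrDl !mulrDr pp qq (addrC p) addrACA => /(canRL (addrK _)).
rewrite subrr => pqqp.
have qpN : q * p = - (p * q) by apply/eqP; rewrite -addr_eq0 addrC pqqp.
have pqp : p * q * p = - (p * q) by rewrite -mulrA qpN mulrN mulrA pp.
have pqpE : p * q * p = p * q.
  by rewrite -[p * q]opprK -qpN mulNr -mulrA pp.
have : (2 : R[i]) *: (p * q) = 0.
  by rewrite scaler_nat mulr2n -{1}pqpE pqp addNr.
by move=> /eqP; rewrite scaler_eq0 pnatr_eq0 /= => /eqP.
Qed.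

Lemma orthogonal_sum_sqr n (l : 'I_n -> R[i]) (p : 'I_n -> A) :
  (forall i, is_idempotent (p i)) -> (forall i j, i != j -> p i * p j = 0) ->
  (\sum_i l i *: p i) ^+ 2 = \sum_i (l i ^+ 2) *: p i.
Proof.
move=> pp pij; rewrite expr2 mulr_suml; apply: eq_bigr => i _.
rewrite mulr_sumr (bigD1 i)//= big1 => [|j ji].
  by rewrite addr0 -banach_scalerAl -banach_scalerAr pp scalerA.
by rewrite -banach_scalerAl -banach_scalerAr pij 1?eq_sym// !scaler0.
Qed.

End Banach.

Section BanachMap.
Variables (R : realType) (A B : banachAlgType R).

Lemma bounded_linear_cts (f : {linear A -> B}) :
  bounded_linear f -> continuous f.
Proof.
move=> [M fM]; apply: bounded_linear_continuous; apply/linear_boundedP.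
exists M%:C%C; split=> [|r Mr x]; first by rewrite complex_real.
by rewrite (le_trans (fM x))// ler_wpM2r// ltW.
Qed.

(** One linear map covering [h * g * Phi x], [Phi x * (g * h)] and [g * Phi x]. *)
Definition bimul_map (c d : B) (f : {linear A -> B}) (x : A) := c * f x * d.

Lemma bimul_map_is_linear c d f : linear (bimul_map c d f).
Proof.
move=> k x y; rewrite /bimul_map linearP mulrDr mulrDl.
by rewrite -banach_scalerAr -banach_scalerAl.
Qed.

HB.instance Definition _ c d f :=
  GRing.isLinear.Build R[i] A B *:%R (bimul_map c d f)
    (bimul_map_is_linear c d f).

Lemma bimul_map_continuous c d (f : {linear A -> B}) :
  continuous f -> continuous (bimul_map c d f).
Proof.
move=> fc x; apply: banach_cvgM; last exact: cvg_cst.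
by apply: banach_cvgM; [exact: cvg_cst|exact: fc].
Qed.

(** The case of [h + k] says that [f] respects the cross term [h * k + k * h], which ['i] merely
    rescales. *)
Lemma jordan_polarization (f : {linear A -> B}) (h k : A) :
  f (h ^+ 2) = f h ^+ 2 -> f (k ^+ 2) = f k ^+ 2 ->
  f ((h + k) ^+ 2) = f (h + k) ^+ 2 ->
  f ((h + 'i *: k) ^+ 2) = f (h + 'i *: k) ^+ 2.
Proof.
have sqrD (C : banachAlgType R) (a b : C) z : (a + z *: b) ^+ 2 =
    a ^+ 2 + z ^+ 2 *: b ^+ 2 + z *: (a * b + b * a).
  rewrite !expr2 mulrDl !mulrDr -!banach_scalerAr -!banach_scalerAl.
  rewrite scalerA -addrA [in RHS]addrAC -addrA; congr (_ + _).
  by rewrite addrA scalerDr.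
have fZ z x : f (z *: x) = z *: f x by rewrite linearZ.
move=> fh fk; rewrite -[k in h + k]scale1r !(linearD f) !fZ !sqrD.
rewrite !expr1n !scale1r !(linearD f) !fZ !(linearD f) fh fk.
by move=> /addrI ->.
Qed.

End BanachMap.

Section RealRankZero.
Variables (R : realType) (A : cstarAlgType R).

Lemma hermitianD (h k : A) :
  is_hermitian h -> is_hermitian k -> is_hermitian (h + k).
Proof. by rewrite /is_hermitian starD => -> ->. Qed.

Lemma starB (x y : A) : star (x - y) = star x - star y.
Proof. by rewrite -(scaleN1r y) starD starZ rmorphN1 scaleN1r. Qed.

Lemma hermitian_decomposition (x : A) : exists h k : A,
  [/\ is_hermitian h, is_hermitian k & x = h + 'i *: k].
Proof.
(* Real and imaginary parts of [x], with [- 'i / 2] for the inverse of [2 * 'i]. *)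
exists (2^-1 *: (x + star x)), (- 'i / 2 *: (x - star x)); split.
- by rewrite /is_hermitian starZ starD starK fmorphV rmorph_nat addrC.
- rewrite /is_hermitian starZ starB starK rmorphM rmorphN fmorphV.
  by rewrite rmorph_nat /= conjCi opprK -opprB scalerN mulNr scaleNr.
- rewrite scalerA mulrA mulrN -expr2 sqrCi opprK mul1r -scalerDr.
  rewrite addrACA subrr addr0 -mulr2n -[x *+ 2]scaler_nat.
  by rewrite scalerA mulVf ?scale1r.
Qed.

(** The set where [f] and [g] agree is closed. Linearity is not assumed, so that maps involving
    squares are covered. *)
Lemma hermitian_eq_continuous (B : banachAlgType R) (f g : A -> B) :
  real_rank_zero A -> continuous f -> continuous g ->
  (forall x, orth_proj_comb x -> f x = g x) ->
  forall h, is_hermitian h -> f h = g h.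
Proof.
move=> rr0 fc gc fg h /rr0 hcl; apply/subr0_eq.
have cl : closed ((f \- g) @^-1` [set 0])%classic.
  apply: preimage_closed => [x _|]; first exact: cvgB (fc x) (gc x).
  exact/accessible_closed_set1/hausdorff_accessible/norm_hausdorff.
apply: (cl h); apply: closureS hcl => x /fg /= fgx.
by rewrite /preimage /= /GRing.sub_fun fgx subrr.
Qed.

Lemma linear_projection_ext (B : banachAlgType R) (f g : {linear A -> B}) :
  real_rank_zero A -> continuous f -> continuous g ->
  (forall p : A, is_projection p -> f p = g p) -> f =1 g.
Proof.
move=> rr0 fc gc fg x.
have fgh h : is_hermitian h -> f h = g h.
  apply: hermitian_eq_continuous => // _ [n [l [p [pp _ ->]]]].
  by rewrite !linear_sum; apply: eq_bigr => i _; rewrite !linearZ /= fg.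
have [h [k [hh hk ->]]] := hermitian_decomposition x.
by rewrite !linearD !linearZ /= !fgh.
Qed.

Lemma jordan_hom_of_idempotents (B : banachAlgType R) (f : {linear A -> B}) :
  real_rank_zero A -> continuous f ->
  (forall p : A, is_idempotent p -> is_idempotent (f p)) -> jordan_hom f.
Proof.
move=> rr0 fc fid.
have fherm : forall h : A, is_hermitian h -> f (h ^+ 2) = f h ^+ 2.
  apply: (@hermitian_eq_continuous B (fun x => f (x ^+ 2)) (fun x => f x ^+ 2))
    => // [x|x|_ [n [l [p [pp pij ->]]]]].
  - exact: (continuous_comp (banach_sqr_continuous (x := x)) (fc (x ^+ 2))).
  - exact: (continuous_comp (fc x) (banach_sqr_continuous (x := f x))).
  have pid i : is_idempotent (p i) by have [] := pp i.
  rewrite orthogonal_sum_sqr// !linear_sum /=.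
  under [in RHS]eq_bigr do rewrite linearZ.
  rewrite orthogonal_sum_sqr => [|i|i j ij].
  - by apply: eq_bigr => i _; rewrite linearZ.
  - exact/fid/pid.
  (* The sum of two orthogonal idempotents is idempotent, hence so is its image. *)
  - apply: idempotentD_orthogonal; [exact/fid/pid|exact/fid/pid|].
    rewrite -linearD; apply: fid; rewrite /is_idempotent mulrDl !mulrDr !pid.
    by rewrite (pij i j)// (pij j i) 1?eq_sym// addr0 add0r.
move=> x; have [h [k [hh hk ->]]] := hermitian_decomposition x.
by apply: jordan_polarization; apply: fherm => //; exact: hermitianD.
Qed.

End RealRankZero.

Theorem theorem3p7 (R : realType) (A : cstarAlgType R) (B : banachAlgType R)
    (Phi : {linear A -> B}) :
  real_rank_zero A ->
  bounded_linear Phi ->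
  (forall a b : A, minus_le a b -> minus_le (Phi a) (Phi b)) ->
  (is_idempotent (Phi 1) -> jordan_hom Phi) /\
  ((exists a : A, is_invertible (Phi a)) -> is_regular (Phi 1) ->
   exists (c : B) (Psi : {linear A -> B}),
     [/\ is_invertible c, jordan_hom Psi & forall x : A, Phi x = c * Psi x]).
Proof.
move=> rr0 /bounded_linear_cts Phic Phile.
have Phi1 p : is_idempotent p -> minus_le (Phi p) (Phi 1).
  by move=> /idempotent_minus_le1/Phile.
split=> [id1|[a [y [ya ay]]] [g hgh]].
  apply: jordan_hom_of_idempotents => // p /Phi1.
  by move=> /minus_le_idempotent; exact.
set h := Phi 1 in hgh Phi1 *.
have hg : h * g = 1.
  (* At [a], this identity multiplied by [y] on the right yields [h * g = 1]. *)
  suff E : bimul_map (h * g) 1 Phi =1 Phi.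
    have := E a; rewrite /bimul_map mulr1 => /(congr1 ( *%R^~ y)).
    by rewrite -(mulrA (h * g)) ay mulr1.
  apply: linear_projection_ext => //; first exact: bimul_map_continuous.
  move=> p [/Phi1/minus_le_geninv/(_ hgh)[hgp _] _].
  by rewrite /= /bimul_map mulr1.
have gh : g * h = 1.
  suff E : bimul_map 1 (g * h) Phi =1 Phi.
    have := E a; rewrite /bimul_map mul1r => /(congr1 ( *%R y)).
    by rewrite mulrA ya mul1r.
  apply: linear_projection_ext => //; first exact: bimul_map_continuous.
  move=> p [/Phi1/minus_le_geninv/(_ hgh)[_ pgh] _].
  by rewrite /= /bimul_map mul1r mulrA.
exists h, (bimul_map g 1 Phi); split; first by exists g.
  apply: jordan_hom_of_idempotents => //; first exact: bimul_map_continuous.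
  (* [Phi p = h * q] with [q] idempotent, so [g * Phi p] is [q] itself. *)
  move=> p /Phi1/minus_le_factor[_ [q [qq _ _ Phipq]]].
  by rewrite /= /bimul_map mulr1 Phipq mulrA gh mul1r.
by move=> x; rewrite /= /bimul_map mulr1 mulrA hg mul1r.
Qed.
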